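(* For every frame $L$, the inclusion $\mathsf{S}_{\mathcal{E}}(L)\subseteq \mathsf{S}(L)$ of the exact sublocales of $L$ into all sublocales of $L$ is a subcolocale inclusion.
   Context: A sublocale of a frame $L$ is a subset $S\subseteq L$ closed under all meets and such that $x\to s\in S$ for all $x\in L$, $s\in S$. The collection $\mathsf{S}(L)$ of all sublocales, ordered by inclusion, is a coframe. Its difference operator is $S\setminus T=\bigcap\{U\in\mathsf{S}(L):S\subseteq T\vee U\}$. A subcolocale of $\mathsf{S}(L)$ (dual of a sublocale) is a subset $\mathcal{S}\subseteq\mathsf{S}(L)$ closed under all joins and such that $S\setminus T\in\mathcal{S}$ whenever $S\in\mathcal{S}$ and $T\in\mathsf{S}(L)$. The frame surjection corresponding to a sublocale $S$ is $\sigma_S:L\to S$, $x\mapsto\bigwedge\{s\in S:x\le s\}$. A meet $\bigwedge_i x_i$ in a frame is exact if $(\bigwedge_i x_i)\vee a=\bigwedge_i(x_i\vee a)$ for all $a$. A frame map $f:L\to M$ is exact if for every exact meet $\bigwedge_i x_i$ in $L$, the meet $\bigwedge_i f(x_i)$ is exact and equals $f(\bigwedge_i x_i)$. A sublocale $S$ is exact if $\sigma_S$ is an exact frame map; $\mathsf{S}_{\mathcal{E}}(L)$ is the collection of exact sublocales. *)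

(* Defs.v *)
From HB Require Import structures.
From mathcomp Require Import all_boot all_order.
From mathcomp Require Import boolp classical_sets.

Set Implicit Arguments.
Unset Strict Implicit.
Unset Printing Implicit Defensive.

Import Order.TTheory.
Local Open Scope classical_set_scope.
Local Open Scope order_scope.

HB.mixin Record TBDistrLattice_isFrame d T of Order.TBDistrLattice d T := {
  Join : set T -> T;
  Join_supremum : forall A : set T, supremums A (Join A);
  meet_Join : forall (x : T) (A : set T),
    x `&` Join A = Join [set x `&` a | a in A]
}.

#[short(type="frameType")]
HB.structure Definition Frame d :=
  { T of Order.TBDistrLattice d T & TBDistrLattice_isFrame d T }.

Section FrameTheory.
Context (d : Order.disp_t) (L : frameType d).
Implicit Types (x y z : L) (A : set L).

Definition Meet A : L := Join (lbound A).

Definition imp x y : L := Join [set z | z `&` x <= y].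

Definition exact_meet A : Prop :=
  forall a : L, Meet A `|` a = Meet [set x `|` a | x in A].

Lemma Join_ub A x : A x -> x <= Join A.
Proof. by case: (Join_supremum A) => + _; exact. Qed.

Lemma Join_le A z : (forall x, A x -> x <= z) -> Join A <= z.
Proof. by case: (Join_supremum A) => _; exact. Qed.

Lemma Meet_lb A x : A x -> Meet A <= x.
Proof. by move=> Ax; apply: Join_le => y; exact. Qed.

Lemma le_Meet A z : (forall x, A x -> z <= x) -> z <= Meet A.
Proof. by move=> zA; apply: Join_ub. Qed.

Lemma le_imp x y z : (z <= imp x y) = (z `&` x <= y).
Proof.
apply/idP/idP => [le_z|]; last by move=> ?; apply: Join_ub.
apply: (le_trans (leI2 le_z (lexx x))); rewrite meetC meet_Join.
by apply: Join_le => _ [w /= wxy <-]; rewrite meetC.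
Qed.

End FrameTheory.

Record is_frame_map d (L : frameType d) d' (M : frameType d') (f : L -> M)
    : Prop := IsFrameMap {
  frame_map_top : f \top = \top;
  frame_map_meet : forall x y, f (x `&` y) = f x `&` f y;
  frame_map_Join : forall A : set L, f (Join A) = Join (f @` A)
}.

Definition exact_map d (L : frameType d) d' (M : frameType d') (f : L -> M)
    : Prop :=
  is_frame_map f /\
  forall A : set L, exact_meet A ->
    exact_meet (f @` A) /\ Meet (f @` A) = f (Meet A).

Record is_sublocale d (L : frameType d) (S : set L) : Prop := IsSublocale {
  sublocale_Meet : forall A : set L, A `<=` S -> S (Meet A);
  sublocale_imp : forall x s : L, S s -> S (imp x s)
}.

Record sublocale d (L : frameType d) : Type := Sublocale {
  sublocale_set :> set L;
  sublocaleP : is_sublocale sublocale_set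
}.

Definition nucleus d (L : frameType d) (S : sublocale L) (x : L) : L :=
  Meet [set s | sublocale_set S s /\ x <= s].

Section Nucleus.
Context d (L : frameType d) (S : sublocale L).
Implicit Types (x s : L).

Lemma nucleus_in x : sublocale_set S (nucleus S x).
Proof. by apply: (sublocale_Meet (sublocaleP S)) => s []. Qed.

Lemma nucleus_ge x : x <= nucleus S x.
Proof. by apply: le_Meet => s []. Qed.

Lemma nucleus_le x s : sublocale_set S s -> (nucleus S x <= s) = (x <= s).
Proof.
move=> Ss; apply/idP/idP; first by apply: le_trans (nucleus_ge x).
by move=> xs; apply: Meet_lb.
Qed.

Lemma nucleus_id s : sublocale_set S s -> nucleus S s = s.
Proof. by move=> Ss; apply/le_anti; rewrite nucleus_ge nucleus_le // lexx. Qed.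

Lemma sublocale_meet x y :
  sublocale_set S x -> sublocale_set S y -> sublocale_set S (x `&` y).
Proof.
move=> Sx Sy; have -> : x `&` y = Meet [set x; y].
  apply/le_anti/andP; split; last by rewrite lexI !Meet_lb //=; [right|left].
  by apply: le_Meet => _ [] ->; rewrite ?leIl ?leIr.
by apply: (sublocale_Meet (sublocaleP S)) => _ [] ->.
Qed.

Lemma sublocale_top : sublocale_set S \top.
Proof.
have <- : nucleus S \top = \top by apply/le_anti; rewrite lex1 nucleus_ge.
exact: nucleus_in.
Qed.

End Nucleus.

(* A sublocale with the order induced from L is a frame. Its meets are those
   of L; its joins are the joins of L followed by the nucleus. *)
Definition sublocale_type d (L : frameType d) (S : sublocale L) : Type :=
  {x : L | x \in sublocale_set S}.

Section SublocaleFrame.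
Context d (L : frameType d) (S : sublocale L).
Local Notation M := (sublocale_type S).

HB.instance Definition _ := [isSub for @sval L _ : M -> L].
HB.instance Definition _ := [Choice of M by <:].
HB.instance Definition _ := [SubChoice_isSubPOrder of M by <: with d].

Definition to_sublocale (x : L) (Sx : sublocale_set S x) : M :=
  exist _ x (mem_set Sx).

Lemma sublocale_val (u : M) : sublocale_set S (val u).
Proof. by case: u => x /= /set_mem. Qed.

Definition sublocale_quotient (x : L) : M := to_sublocale (nucleus_in S x).

Lemma sublocale_quotient_le x (u : M) :
  (sublocale_quotient x <= u) = (x <= val u).
Proof. by rewrite leEsub /= nucleus_le //; exact: sublocale_val. Qed.

Let meetM (u v : M) : M :=
  to_sublocale (sublocale_meet (sublocale_val u) (sublocale_val v)).
Let joinM (u v : M) : M := sublocale_quotient (val u `|` val v).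

Let lexIM (u v w : M) : (u <= meetM v w) = (u <= v) && (u <= w).
Proof. by rewrite !leEsub /= lexI. Qed.

Let leUxM (u v w : M) : (joinM u v <= w) = (u <= w) && (v <= w).
Proof. by rewrite sublocale_quotient_le leUx -!leEsub. Qed.

HB.instance Definition _ :=
  Order.POrder_MeetJoin_isLattice.Build d M lexIM leUxM.

Let topM : M := to_sublocale (sublocale_top S).
Let lex1M (u : M) : u <= topM. Proof. by rewrite leEsub lex1. Qed.
HB.instance Definition _ := Order.hasTop.Build d M lex1M.

Let botM : M := sublocale_quotient \bot.
Let le0xM (u : M) : botM <= u.
Proof. by rewrite sublocale_quotient_le le0x. Qed.
HB.instance Definition _ := Order.hasBottom.Build d M le0xM.

Lemma val_sublocale_meet (u v : M) : val (u `&` v) = val u `&` val v.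
Proof. by []. Qed.

Lemma val_sublocale_join (u v : M) :
  val (u `|` v) = nucleus S (val u `|` val v).
Proof. by []. Qed.

Let impM (u v : M) : M :=
  to_sublocale (sublocale_imp (sublocaleP S) (val u) (sublocale_val v)).

Let le_impM (u v w : M) : (w <= impM u v) = (w `&` u <= v).
Proof. by rewrite !leEsub /= le_imp. Qed.

Let meetUlM : left_distributive (@Order.meet d M) (@Order.join d M).
Proof.
move=> u v w; apply/le_anti/andP; split; last first.
  by rewrite leUx !leI2 ?leUl ?leUr.
by rewrite -le_impM leUx !le_impM leUl leUr.
Qed.

HB.instance Definition _ :=
  Order.Lattice_Meet_isDistrLattice.Build d M meetUlM.

Let JoinM (A : set M) : M := sublocale_quotient (Join (val @` A)).

Let JoinM_supremum (A : set M) : supremums A (JoinM A).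
Proof.
split=> [u Au|u uA].
  rewrite leEsub /=; apply: le_trans (nucleus_ge _ _).
  by apply: Join_ub; exists u.
rewrite sublocale_quotient_le; apply: Join_le => _ [v Av <-].
by rewrite -leEsub; exact: uA.
Qed.

Let meet_JoinM (u : M) (A : set M) :
  u `&` JoinM A = JoinM [set u `&` a | a in A].
Proof.
have [ubA leA] := JoinM_supremum A.
have [ubB leB] := JoinM_supremum [set u `&` a | a in A].
apply/le_anti/andP; split.
  rewrite meetC -le_impM; apply: leA => a Aa; rewrite le_impM meetC.
  by apply: ubB; exists a.
by apply: leB => _ [a Aa <-]; rewrite leI2 //; exact: ubA.
Qed.

HB.instance Definition _ :=
  TBDistrLattice_isFrame.Build d M JoinM_supremum meet_JoinM.

Lemma val_sublocale_Join (A : set M) :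
  val (Join A) = nucleus S (Join (val @` A)).
Proof. by []. Qed.

Lemma val_sublocale_Meet (A : set M) : val (Meet A) = Meet (val @` A).
Proof.
apply/le_anti/andP; split.
  apply: le_Meet => _ [u Au <-]; rewrite -leEsub; exact: Meet_lb.
have SA : sublocale_set S (Meet (val @` A)).
  apply: (sublocale_Meet (sublocaleP S)) => _ [u _ <-]; exact: sublocale_val.
rewrite -[leLHS]/(val (to_sublocale SA)) -leEsub.
by apply: le_Meet => u Au; rewrite leEsub /=; apply: Meet_lb; exists u.
Qed.

Lemma sublocale_quotient_frame_map : is_frame_map sublocale_quotient.
Proof.
split.
- by apply/le_anti; rewrite lex1 leEsub nucleus_ge.
- move=> x y; apply/le_anti/andP; split.
    by rewrite sublocale_quotient_le val_sublocale_meet leI2 ?nucleus_ge.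
  rewrite -le_impM sublocale_quotient_le /= le_imp meetC -le_imp.
  rewrite nucleus_le ?le_imp 1?meetC ?nucleus_ge //.
  by apply: (sublocale_imp (sublocaleP S)); exact: nucleus_in.
- move=> A; apply/le_anti/andP; split.
    rewrite sublocale_quotient_le; apply: Join_le => x Ax.
    by rewrite -sublocale_quotient_le; apply: Join_ub; exists x.
  apply: Join_le => _ [x Ax <-]; rewrite sublocale_quotient_le.
  exact: le_trans (Join_ub Ax) (nucleus_ge _ _).
Qed.

End SublocaleFrame.

Definition exact_sublocale d (L : frameType d) : set (sublocale L) :=
  [set S | exact_map (sublocale_quotient S)].

Section SublocaleCoframe.
Context d (L : frameType d).
Implicit Types (S T U : sublocale L) (F : set (sublocale L)).

Lemma is_sublocale_inter F : is_sublocale (\bigcap_(S in F) S).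
Proof.
split=> [A AF S FS|x s sF S FS].
  by apply: (sublocale_Meet (sublocaleP S)) => a /AF; exact.
by apply: (sublocale_imp (sublocaleP S)); exact: sF.
Qed.

Definition sublocale_inter F : sublocale L := Sublocale (is_sublocale_inter F).

Definition sublocale_join F : sublocale L :=
  sublocale_inter [set U | forall S, F S -> S `<=` U].

Definition sublocale_diff S T : sublocale L :=
  sublocale_inter [set U | S `<=` sublocale_join [set T; U]].

Lemma sublocale_join_ub F S : F S -> S `<=` sublocale_join F.
Proof. by move=> FS x Sx U FU; exact: FU Sx. Qed.

Lemma sublocale_join_le F U :
  (forall S, F S -> S `<=` U) -> sublocale_join F `<=` U.
Proof. by move=> FU x; apply. Qed.

Record is_subcolocale (C : set (sublocale L)) : Prop := IsSubcolocale {
  subcolocale_join : forall F, F `<=` C -> C (sublocale_join F);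
  subcolocale_diff : forall S T, C S -> C (sublocale_diff S T)
}.

End SublocaleCoframe.

(* Main.v *)
Require Import Defs.
From mathcomp Require Import all_boot all_order.
From mathcomp Require Import classical_sets.

Set Implicit Arguments.
Unset Strict Implicit.
Unset Printing Implicit Defensive.

Import Order.TTheory.
Local Open Scope classical_set_scope.
Local Open Scope order_scope.

(** Write [s], [t] for the nuclei of sublocales [S], [T]. Exact meets are stable
    under joining with a fixed element, and a quotient map respects binary
    joins; so the exactness of the image meets comes for free, and [S] is exact
    as soon as [s] preserves exact meets as a map from [L] to [L]
    ([exact_sublocaleP]).

    The nucleus of a join of sublocales is the pointwise meet of their nuclei
    ([nucleus_join_glb]), and pointwise meets preserve whatever meets their
    terms preserve. This settles closure under joins.

    For the difference, the nucleus [r] of [S \ T] is the Heyting implication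
    from [t] to [s] in the frame of nuclei, that is
    [r x = Meet_(b >= x) (t b -> s b)]; this is the content of [meet_nucleus_diff]
    and [le_nucleus_diff]. Let the meet [x] of the [x_i] be exact and let [u] lie
    below every [r x_i]. For each [b >= x],
      [u /\ t b <= r (x_i \/ b) /\ t (x_i \/ b) <= s (x_i \/ b)],
    and exactness gives [Meet_i s (x_i \/ b) = s (x \/ b) = s b]. Hence
    [u <= t b -> s b] for every such [b], that is [u <= r x]. *)

Section Exactness.
Context (d : Order.disp_t) (L : frameType d).
Implicit Types (S T U : sublocale L) (F : set (sublocale L)) (A : set L).
Implicit Types (a b u x y z : L).

Lemma le_nucleus S x y : x <= y -> nucleus S x <= nucleus S y.
Proof.
move=> xy; rewrite nucleus_le; last exact: nucleus_in.
exact: le_trans xy (nucleus_ge S y).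
Qed.

Lemma nucleus_impI S x y : nucleus S (imp x y) `&` x <= nucleus S y.
Proof.
rewrite -le_imp nucleus_le; last first.
  by apply: (sublocale_imp (sublocaleP S)); exact: nucleus_in.
by rewrite le_imp; apply: le_trans (nucleus_ge S y); rewrite -le_imp.
Qed.

Lemma exact_meet_joinr A a : exact_meet A -> exact_meet [set x `|` a | x in A].
Proof.
move=> exA b; rewrite -exA -joinA exA; congr Meet.
apply/seteqP; split=> [_ [x Ax <-]|_ [_ [x Ax <-] <-]].
  by exists (x `|` a); [exists x | rewrite joinA].
by exists x => //; rewrite joinA.
Qed.

Definition preserves_exact_meets S : Prop :=
  forall A u, exact_meet A -> (forall x, A x -> u <= nucleus S x) ->
    u <= nucleus S (Meet A).

(** The meet of the images is again exact in [S]: joining it with [a] amounts to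
    taking the image of the meet of the [x \/ a], which is itself exact. *)
Lemma exact_sublocaleP S : exact_sublocale S <-> preserves_exact_meets S.
Proof.
split=> [[_ exS] A u exA uA|prS].
  have [_ /(congr1 val)] := exS A exA; rewrite val_sublocale_Meet /= => <-.
  by apply: le_Meet => _ [_ [x Ax <-] <-]; exact: uA.
split; first exact: sublocale_quotient_frame_map.
move=> A exA; split=> [a|]; apply/le_anti/andP; split.
- apply: le_Meet => _ [_ [x Ax <-] <-]; apply: leU2 => //.
  by apply: Meet_lb; exists x.
- rewrite leEsub val_sublocale_join.
  apply: (@le_trans _ _ (nucleus S (Meet A `|` val a))); last first.
    apply/le_nucleus/leU2 => //; rewrite val_sublocale_Meet.
    apply: le_Meet => _ [_ [x Ax <-] <-].
    exact: le_trans (Meet_lb Ax) (nucleus_ge S x).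
  rewrite exA; apply: prS; first exact: exact_meet_joinr.
  move=> _ [x Ax <-]; rewrite val_sublocale_Meet.
  apply: (@le_trans _ _ (val (sublocale_quotient S x `|` a))).
    apply: Meet_lb; exists (sublocale_quotient S x `|` a) => //.
    by exists (sublocale_quotient S x) => //; exists x.
  rewrite val_sublocale_join nucleus_le /=; last exact: nucleus_in.
  rewrite leUx le_nucleus ?leUl //=.
  exact: le_trans (leUr _ _) (nucleus_ge S _).
- rewrite leEsub; apply: prS => // x Ax; rewrite val_sublocale_Meet.
  by apply: Meet_lb; exists (sublocale_quotient S x) => //; exists x.
- apply: le_Meet => _ [x Ax <-]; rewrite leEsub /=.
  by apply/le_nucleus/Meet_lb.
Qed.

Lemma is_sublocale_join_fixpoints F :
  is_sublocale
    [set x | forall u, (forall S, F S -> u <= nucleus S x) -> u <= x].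
Proof.
split=> [A fixA u uA|z x fixx u ux].
  apply: le_Meet => x Ax; apply: (fixA x Ax) => S FS.
  exact: le_trans (uA S FS) (le_nucleus S (Meet_lb Ax)).
rewrite le_imp; apply: fixx => S FS.
exact: le_trans (leI2 (ux S FS) (lexx z)) (nucleus_impI S z x).
Qed.

(** The fixed points of the pointwise meet of the nuclei form a sublocale that
    contains every member of [F], hence their join. *)
Lemma nucleus_join_glb F u x :
  (forall S, F S -> u <= nucleus S x) -> u <= nucleus (sublocale_join F) x.
Proof.
move=> uF; pose V := Sublocale (is_sublocale_join_fixpoints F).
have sFV : sublocale_join F `<=` V.
  apply: sublocale_join_le => S FS y Sy v vy.
  by rewrite -(nucleus_id Sy); exact: vy.
apply: (sFV _ (nucleus_in _ x)) => S FS.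
exact: le_trans (uF S FS) (le_nucleus S (nucleus_ge _ x)).
Qed.

Lemma nucleus_sub S T x : S `<=` T -> nucleus T x <= nucleus S x.
Proof. by move=> ST; rewrite nucleus_le ?nucleus_ge //; exact/ST/nucleus_in. Qed.

Lemma exact_sublocale_join F :
  F `<=` @exact_sublocale d L -> exact_sublocale (sublocale_join F).
Proof.
move=> exF; apply/exact_sublocaleP => A u exA uA.
apply: nucleus_join_glb => S FS.
have /exact_sublocaleP prS := exF S FS.
apply: prS => // x Ax; apply: le_trans (uA x Ax) _.
exact/nucleus_sub/sublocale_join_ub.
Qed.

(** The fixed points of the map [a |-> Meet_(b >= a) (t b -> s b)]. *)
Definition diff_fixpoints S T : set L :=
  [set a | forall u,
     (forall b, a <= b -> u `&` nucleus T b <= nucleus S b) -> u <= a].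

Lemma is_sublocale_diff_fixpoints S T : is_sublocale (diff_fixpoints S T).
Proof.
split=> [A fixA u uA|x a fixa u ua].
  apply: le_Meet => a Aa; apply: (fixA a Aa) => b ab.
  exact: uA (le_trans (Meet_lb Aa) ab).
rewrite le_imp; apply: fixa => b ab.
(* The condition on [u] is used at [imp x b], which lies above [imp x a]. *)
have le_b : b <= imp x b by rewrite le_imp leIl.
have ab' : imp x a <= imp x b.
  by rewrite le_imp; apply: le_trans ab; rewrite -le_imp.
apply: le_trans (nucleus_impI S x b); rewrite lexI; apply/andP; split.
  by apply: le_trans (ua _ ab'); apply: leI2; [exact: leIl|exact: le_nucleus].
exact: le_trans (leIl _ _) (leIr _ _).
Qed.

(** Each [x] in [S] is the meet of [t x], which lies in [T], and of
    [t x -> x], which is a fixed point lying in [S]. *)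
Lemma sub_join_diff_fixpoints S T U :
  diff_fixpoints S T `<=` U -> S `<=` sublocale_join [set T; U].
Proof.
move=> RU x Sx; set c := imp (nucleus T x) x.
have Sc : sublocale_set S c by exact: (sublocale_imp (sublocaleP S)).
have le_c : c `&` nucleus T x <= x by rewrite -le_imp.
have Rc : diff_fixpoints S T c.
  move=> u /(_ c (lexx c)); rewrite (nucleus_id Sc) => uc.
  have xc : x <= c by rewrite le_imp leIl.
  rewrite le_imp; apply: le_trans le_c; rewrite lexI leIr andbT.
  by apply: le_trans uc; rewrite leI2 // le_nucleus.
have -> : x = c `&` nucleus T x.
  by apply/le_anti; rewrite le_c lexI nucleus_ge le_imp leIl.
apply: sublocale_meet.
  by apply: (@sublocale_join_ub _ _ _ U); [right|exact: RU].
by apply: (@sublocale_join_ub _ _ _ T); [left|exact: nucleus_in].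
Qed.

(** If [S] is contained in the join of [T] and [U], the nucleus of that join,
    the pointwise meet of [t] and the nucleus of [U], lies below [s]. So the
    nucleus of [U] lies below each implication [t b -> s b]. *)
Lemma diff_fixpoints_sub S T : diff_fixpoints S T `<=` sublocale_diff S T.
Proof.
move=> a fixa U SU; suff <- : nucleus U a = a by exact: nucleus_in.
apply/le_anti; rewrite nucleus_ge andbT; apply: fixa => b ab.
apply: le_trans (nucleus_sub b SU); apply: nucleus_join_glb => _ [] ->.
  exact: leIr.
exact: le_trans (leIl _ _) (le_nucleus U ab).
Qed.

Lemma sub_diff_fixpoints S T : sublocale_diff S T `<=` diff_fixpoints S T.
Proof.
move=> x /(_ (Sublocale (is_sublocale_diff_fixpoints S T))); apply.
exact: sub_join_diff_fixpoints.
Qed.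

Lemma meet_nucleus_diff S T x :
  nucleus (sublocale_diff S T) x `&` nucleus T x <= nucleus S x.
Proof.
apply: le_trans (nucleus_sub x (sub_join_diff_fixpoints (@diff_fixpoints_sub S T))).
by apply: nucleus_join_glb => _ [] ->; rewrite ?leIl ?leIr.
Qed.

Lemma le_nucleus_diff S T u x :
  (forall b, x <= b -> u `&` nucleus T b <= nucleus S b) ->
  u <= nucleus (sublocale_diff S T) x.
Proof.
move=> ux; apply: (sub_diff_fixpoints (nucleus_in _ x)) => b xb.
exact: ux (le_trans (nucleus_ge _ x) xb).
Qed.

Lemma exact_sublocale_diff S T :
  exact_sublocale S -> exact_sublocale (sublocale_diff S T).
Proof.
move=> /exact_sublocaleP prS; apply/exact_sublocaleP => A u exA uA.
apply: le_nucleus_diff => b Ab.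
have -> : b = Meet [set x `|` b | x in A] by rewrite -exA join_r.
apply: prS; first exact: exact_meet_joinr.
move=> _ [x Ax <-]; rewrite -exA join_r //.
apply: le_trans (meet_nucleus_diff S T _); apply: leI2.
  exact: le_trans (uA x Ax) (le_nucleus _ (leUl _ _)).
exact/le_nucleus/leUr.
Qed.

End Exactness.

Theorem theorem5p10 (d : Order.disp_t) (L : frameType d) :
  is_subcolocale (@exact_sublocale d L).
Proof.
split=> [F|S T]; [exact: exact_sublocale_join|exact: exact_sublocale_diff].
Qed.
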